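(* For all $n\ge 1$, $$\sum_{\lambda\vdash n}(-1)^{e(\lambda)}I_\lambda^2=0,$$ where the sum ranges over all partitions $\lambda$ of $n$, $e(\lambda)=\lambda_2+\lambda_4+\cdots$ is the sum of all even-indexed parts of $\lambda$, and $I_\lambda$ is the imbalance of $\lambda$.
   Context: A standard Young tableau (tableau for short) of shape $\lambda\vdash n$ is a filling of the Young diagram of $\lambda$ (English convention: rows indexed $1,2,\ldots$ from top to bottom, row $i$ having $\lambda_i$ squares, left-justified) with the numbers $1,\ldots,n$, each used once, such that rows increase from left to right and columns increase from top to bottom. Partitions are written $\lambda=(\lambda_1,\lambda_2,\ldots,\lambda_l)$ with $\lambda_1\ge\lambda_2\ge\cdots\ge\lambda_l>0$. For a tableau $T$, a pair $(i,j)$ of entries is an inversion of $T$ if $j<i$ and $j$ is contained in a row below the row of $i$; $\mathrm{inv}(T)$ denotes the number of inversions of $T$. The imbalance of $\lambda$ is $$I_\lambda=\sum_T(-1)^{\mathrm{inv}(T)},$$ where $T$ ranges over all standard Young tableaux of shape $\lambda$.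
   Formalization: The identity is stated for all n ≥ 2 instead of n ≥ 1, since at n = 1 the only partition is (1), with imbalance 1 and e = 0, so the sum equals 1 and not 0. *)

(* Defs.v *)
From HB Require Import structures.
From mathcomp Require Import all_boot all_order all_algebra.

Set Implicit Arguments.
Unset Strict Implicit.
Unset Printing Implicit Defensive.

Import GRing.Theory.

Definition is_intpart (n : nat) (s : seq nat) : bool :=
  [&& sorted geq s, 0 \notin s & sumn s == n].

Record intpart (n : nat) : Type :=
  IntPart { parts :> seq nat; _ : is_intpart n parts }.

HB.instance Definition _ n := [isSub for @parts n].
HB.instance Definition _ n := [Countable of intpart n by <:].

(* A partition of n has at most n parts, each at most n, so it embeds in the
   finite type of sequences of length n over {0, ..., n} by padding with zeros. *)
Definition intpart_pad n (l : intpart n) : n.-tuple 'I_n.+1 :=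
  [tuple inord (nth 0 l i) | i < n].

Definition intpart_unpad n (t : n.-tuple 'I_n.+1) : option (intpart n) :=
  insub [seq k <- [seq val k | k <- t] | k != 0].

Lemma leq_nth_sumn (s : seq nat) i : nth 0 s i <= sumn s.
Proof.
elim: s i => [|a s IHs] [|i] //=; first exact: leq_addr.
exact: leq_trans (IHs i) (leq_addl _ _).
Qed.

Lemma leq_size_sumn (s : seq nat) : 0 \notin s -> size s <= sumn s.
Proof.
elim: s => //= a s IHs; rewrite inE negb_or => /andP[a_neq0 /IHs le_s].
by rewrite -add1n leq_add // lt0n eq_sym.
Qed.

Lemma intpart_padK n : pcancel (@intpart_pad n) (@intpart_unpad n).
Proof.
case=> s s_part; have /and3P[_ s_gt0 /eqP sum_s] := s_part.
rewrite /intpart_unpad /intpart_pad /=.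
have ->: [seq val k | k <- [seq inord (nth 0 s i) : 'I_n.+1 | i : 'I_n <- enum 'I_n]]
         = s ++ nseq (n - size s) 0.
  have le_sn: size s <= n by rewrite -sum_s leq_size_sumn.
  rewrite -map_comp; apply: (@eq_from_nth _ 0).
    by rewrite size_map size_enum_ord size_cat size_nseq subnKC.
  move=> i; rewrite size_map size_enum_ord => lt_in.
  rewrite (nth_map (Ordinal lt_in)) ?size_enum_ord //= nth_enum_ord //.
  rewrite inordK; last by rewrite ltnS -sum_s leq_nth_sumn.
  rewrite nth_cat nth_nseq if_same; case: ltnP => // le_si.
  by rewrite nth_default.
have -> : [seq k <- s ++ nseq (n - size s) 0 | k != 0] = s.
  rewrite filter_cat (all_filterP _).
    by rewrite filter_nseq /= cats0.
  by apply/allP => k k_s; apply: contraNneq s_gt0 => <-.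
rewrite insubT; congr Some; exact: val_inj.
Qed.

HB.instance Definition _ n : isFinite (intpart n) :=
  PCanIsFinite (@intpart_padK n).

(* Rows and columns are numbered from 0. *)
Definition cell (l : seq nat) : Type :=
  {i : 'I_(size l) & 'I_(nth 0 l i)}.

HB.instance Definition _ l := Finite.on (cell l).

Definition row_of l (c : cell l) : nat := tag c.
Definition col_of l (c : cell l) : nat := tagged c.

(* The entry 0 of 'I_(sumn l).+1 is excluded by standard_tableau below. *)
Definition filling (l : seq nat) : Type := {ffun cell l -> 'I_(sumn l).+1}.

HB.instance Definition _ l := Finite.on (filling l).

Definition standard_tableau l (T : filling l) : bool :=
  [&& perm_eq [seq val (T c) | c : cell l] (iota 1 (sumn l)),
      [forall c : cell l, forall d : cell l,
         (row_of c == row_of d) && (col_of c < col_of d) ==> (T c < T d)]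
    & [forall c : cell l, forall d : cell l,
         (col_of c == col_of d) && (row_of c < row_of d) ==> (T c < T d)]].

(* In a tableau a pair of entries is the same as the pair of their cells. *)
Definition inv l (T : filling l) : nat :=
  #|[set p : cell l * cell l | (T p.2 < T p.1) && (row_of p.1 < row_of p.2)]|.

Definition imbalance (l : seq nat) : int :=
  (\sum_(T : filling l | standard_tableau T) (-1) ^+ inv T)%R.

(* The k-th part of l is nth 0 l k.-1, hence the parity shift. *)
Definition even_parts_sum (l : seq nat) : nat :=
  \sum_(i < size l | odd i) nth 0 l i.

(* Main.v *)
(* Removing the largest entry of a tableau gives the recursion
     I_l = sum over the corners r of l of (-1)^(l_(r+1) + l_(r+2) + ...) I_(l - box r),
   i.e., the vector of imbalances is U^n applied to the empty partition, where U
   adds a box with this sign. Let D be the adjoint of U for the bilinear form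
   <l, l> = (-1)^e(l). Adding and deleting boxes in distinct rows anticommute, and
   the addable row r + 1 cancels the removable row r, so that D U + U D = 1. Hence
   D U^n = U^(n-1) on the empty partition for n odd and 0 for n even, and the sum
   S_n = <U^n, U^n> satisfies S_(n+1) = S_n for n even and S_(n+1) = 0 for n odd. *)

Require Import Defs.
From mathcomp Require Import all_boot all_order all_algebra.
From mathcomp Require Import zify ring.

Set Implicit Arguments.
Unset Strict Implicit.
Unset Printing Implicit Defensive.

Import GRing.Theory.

(** * The signed Young lattice *)

(** Partitions are handled as functions from rows to row lengths, so that adding or deleting a box
    is a total operation carrying no proof. *)
Definition add_box (f : nat -> nat) r i := f i + (i == r).
Definition del_box (f : nat -> nat) r i := f i - (i == r).
Definition addable (f : nat -> nat) r := (r == 0) || (f r < f r.-1).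
Definition removable (f : nat -> nat) r := f r.+1 < f r.
(* Rows are numbered from 0, and only the rows [< N] are taken into account. *)
Definition below N (f : nat -> nat) r := \sum_(i < N | r < i) f i.

(** For a partition [f] of [n] with at most [N] rows, this is the coefficient of [f] in U^n applied
    to the empty partition: a signed count of the ways to strip [f] box by box. *)
Fixpoint signed_paths N n (f : nat -> nat) : int :=
  if n is m.+1 then
    (\sum_(r < N | removable f r)
       (-1) ^+ below N f r * signed_paths N m (del_box f r))%R
  else 1%R.

(* Adding a box in row [r] changes the sum of the even-indexed parts by [odd r],
   hence the sign [(-1) ^+ r] of the adjoint of the signed up operator. *)
Definition up_down N n (f : nat -> nat) : int :=
  (\sum_(r < N | addable f r)
     (-1) ^+ r * (-1) ^+ below N f r * signed_paths N n.+1 (add_box f r))%R.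

Lemma eq_below N f g r : f =1 g -> below N f r = below N g r.
Proof. by move=> fg; apply: eq_bigr => i _; rewrite fg. Qed.

Lemma eq_signed_paths N n f g :
  f =1 g -> signed_paths N n f = signed_paths N n g.
Proof.
elim: n f g => //= n IHn f g fg.
apply: eq_big => [r|r _]; first by rewrite /removable !fg.
rewrite (eq_below _ _ fg); congr (_ * _)%R.
by apply: IHn => i; rewrite /del_box fg.
Qed.

Lemma sum_add_box N (P : pred nat) f r : r < N ->
  \sum_(i < N | P i) add_box f r i = \sum_(i < N | P i) f i + P r.
Proof.
move=> ltrN; rewrite big_split /=; congr (_ + _).
rewrite big_mkcond (bigD1 (Ordinal ltrN)) //= eqxx big1 ?addn0; first by case: (P r).
by move=> i; rewrite -val_eqE /= => /negPf->; case: (P i).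
Qed.

Lemma del_boxK f r : 0 < f r -> add_box (del_box f r) r =1 f.
Proof. by move=> fr i; rewrite /add_box /del_box; case: eqP => [->|_] /=; lia. Qed.

Lemma add_boxK f r : del_box (add_box f r) r =1 f.
Proof. by move=> i; rewrite /add_box /del_box; case: eqP => [->|_] /=; lia. Qed.

Lemma sum_del_box N (P : pred nat) f r : r < N -> 0 < f r ->
  \sum_(i < N | P i) del_box f r i + P r = \sum_(i < N | P i) f i.
Proof.
move=> ltrN fr; rewrite -sum_add_box //.
by apply: eq_bigr => i _; rewrite del_boxK.
Qed.

Lemma below_add_box N f r : below N (add_box f r) r = below N f r.
Proof. by apply: eq_bigr => i ltri; rewrite /add_box (gtn_eqF ltri) addn0. Qed.

Lemma below_del_box N f r : below N (del_box f r) r = below N f r.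
Proof. by apply: eq_bigr => i ltri; rewrite /del_box (gtn_eqF ltri) subn0. Qed.

Definition noninc (f : nat -> nat) := forall i, f i.+1 <= f i.

Lemma noninc_le f i j : noninc f -> i <= j -> f j <= f i.
Proof.
move=> fP; elim: j => [|j IHj]; first by rewrite leqn0 => /eqP->.
by rewrite leq_eqVlt => /predU1P[->//|/IHj]; apply: leq_trans.
Qed.

Lemma noninc_add_box f r : noninc f -> addable f r -> noninc (add_box f r).
Proof.
move=> fP + i; have := fP i; rewrite /addable /add_box.
have [<-/=|_] := eqVneq i.+1 r; have [->|_] /= := eqVneq i r; lia.
Qed.

Lemma noninc_del_box f r : noninc f -> removable f r -> noninc (del_box f r).
Proof.
move=> fP + i; have := fP i; rewrite /removable /del_box.
have [<-/=|_] := eqVneq i.+1 r; have [->|_] /= := eqVneq i r; lia.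
Qed.

Lemma del_box_addable f r : noninc f -> removable f r -> addable (del_box f r) r.
Proof.
rewrite /addable /removable /del_box eqxx; case: r => //= k fP.
by have := fP k; rewrite (ltn_eqF (ltnSn k)); lia.
Qed.

Lemma add_box_removable f r : noninc f -> removable (add_box f r) r.
Proof.
by move/(_ r); rewrite /removable /add_box eqxx (gtn_eqF (ltnSn r)); lia.
Qed.

(** A box in row [N.-1] would make all [N] rows nonempty. *)
Lemma noninc_last N f : noninc f -> \sum_(i < N) f i < N -> f N.-1 = 0.
Proof.
move=> fP; apply: contraTeq; rewrite -lt0n -leqNgt => fN.
rewrite -{1}[N]card_ord -sum1_card leq_sum // => i _.
by apply: leq_trans fN _; apply: noninc_le => //; have := ltn_ord i; lia.
Qed.

(** Row [r.+1] is addable exactly when row [r] is removable, and their signs cancel. What remains is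
    the 1 of row 0, always addable; the last row is empty, hence not removable. *)
Lemma sign_corners N f : noninc f -> \sum_(i < N) f i < N ->
  (\sum_(r < N | addable f r) (-1) ^+ r
   + \sum_(r < N | removable f r) (-1) ^+ r = 1 :> int)%R.
Proof.
case: N => [|N] fP; first by rewrite ltn0.
move/(noninc_last fP) => /= fN.
rewrite big_mkcond big_ord_recl /= [X in (_ + X)%R]big_mkcond big_ord_recr /=.
have -> : removable f N = false by rewrite /removable fN ltn0.
rewrite addr0 expr0 -addrA -big_split big1 ?addr0 //= => i _.
by rewrite /addable /removable /bump /= add1n exprS; case: ifP; rewrite ?addr0; lia.
Qed.

(** The two moves interact only if [t] is the row just above [r]; either order then requires
    [f r + 1 < f t]. *)
Lemma corner_swap f r t : t != r ->
  addable f r && removable (add_box f r) t =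
  removable f t && addable (del_box f t) r.
Proof.
rewrite /addable /removable /add_box /del_box => ntr.
case: r ntr => [|r] ntr /=; first by rewrite andbT (negPf ntr) !addn0.
rewrite eqSS (negPf ntr) [r.+1 == t]eq_sym (negPf ntr) [r == t]eq_sym.
by have [->|_] /= := eqVneq t r; lia.
Qed.

Lemma box_swap f r t : t != r ->
  del_box (add_box f r) t =1 add_box (del_box f t) r.
Proof.
move=> ntr i; rewrite /add_box /del_box; have [->|_] := eqVneq i t; last by lia.
by rewrite (negPf ntr); lia.
Qed.

(** Adding in row [r] raises the sum below [t] when [t < r]; deleting in row [t] lowers the sum
    below [r] when [r < t]. Exactly one of these happens. *)
Lemma sign_swap N f r t : r < N -> t < N -> t != r -> 0 < f t ->
  ((-1) ^+ below N f r * (-1) ^+ below N (add_box f r) t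
   = - ((-1) ^+ below N f t * (-1) ^+ below N (del_box f t) r) :> int)%R.
Proof.
move=> rN tN ntr ft; rewrite /below sum_add_box // -(sum_del_box _ tN ft).
rewrite -!exprD -[RHS]mulN1r -exprS -[LHS]signr_odd -[RHS]signr_odd.
by congr (_ ^+ nat_of_bool _)%R; lia.
Qed.

(* The relation D U + U D = 1 of the signed Young lattice, applied to the
   vector of imbalances: the terms which add and delete in distinct rows cancel. *)
Lemma up_down_step N n f : noninc f -> \sum_(i < N) f i = n -> n < N ->
  (up_down N n f = signed_paths N n f -
    \sum_(t < N | removable f t)
       (-1) ^+ below N f t * up_down N n.-1 (del_box f t))%R.
Proof.
move=> fP sumf ltnN.
(* The contribution of adding in row [r], then deleting in row [t]; both compositions are reduced to
   it. *)
pose A r t : int := ((-1) ^+ r * (-1) ^+ below N f r *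
  ((-1) ^+ below N (add_box f r) t *
     signed_paths N n (del_box (add_box f r) t)))%R.
(* The diagonal [t = r] restores [f], and its two equal signs cancel, leaving [(-1) ^+ r]. *)
have up_part : (up_down N n f =
    (\sum_(r < N | addable f r) (-1) ^+ r) * signed_paths N n f +
    \sum_(r < N | addable f r)
       \sum_(t < N | removable (add_box f r) t && (t != r)) A r t)%R.
  rewrite /up_down big_distrl -big_split; apply: eq_bigr => r fr /=.
  rewrite big_distrr (bigD1 r) /=; last exact: add_box_removable.
  congr (_ + _)%R; rewrite (eq_signed_paths _ _ (add_boxK f r)).
  by rewrite below_add_box -mulrA signrMK.
have down_part : (\sum_(t < N | removable f t)
       (-1) ^+ below N f t * up_down N n.-1 (del_box f t) =
    (\sum_(t < N | removable f t) (-1) ^+ t) * signed_paths N n f -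
    \sum_(t < N | removable f t)
       \sum_(r < N | addable (del_box f t) r && (r != t)) A r t)%R.
  rewrite /up_down big_distrl -sumrB; apply: eq_bigr => t ft.
  have ft0 : 0 < f t by exact: leq_ltn_trans ft.
  have n0 : 0 < n.
    by rewrite -sumf (bigD1 t) //= (leq_trans ft0) ?leq_addr.
  rewrite prednK // big_distrr (bigD1 t) /=; last exact: del_box_addable.
  congr (_ + _)%R.
    rewrite (eq_signed_paths _ _ (del_boxK ft0)).
    by rewrite below_del_box -mulrA mulrCA signrMK.
  (* Off the diagonal, the opposite order gives the same shape with the opposite sign. *)
  rewrite -sumrN; apply: eq_bigr => r /andP[_ ntr].
  have ntr' : nat_of_ord t != r by rewrite eq_sym.
  rewrite /A (eq_signed_paths _ _ (box_swap f ntr')).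
  have := sign_swap (ltn_ord r) (ltn_ord t) ntr' ft0.
  set a := ((-1) ^+ below N f r)%R; set b := ((-1) ^+ _)%R => ab.
  rewrite -[(_ * a * _)%R]mulrA [(a * _)%R]mulrA ab; ring.
rewrite up_part down_part.
have -> : (\sum_(r < N | addable f r)
       \sum_(t < N | removable (add_box f r) t && (t != r)) A r t =
    \sum_(t < N | removable f t)
       \sum_(r < N | addable (del_box f t) r && (r != t)) A r t)%R.
  rewrite !pair_big_dep /= (reindex (fun p : 'I_N * 'I_N => (p.2, p.1))) /=.
    by apply: eq_bigl => -[t r] /=; rewrite [r == t]eq_sym;
       case: eqVneq => [|/corner_swap e]; rewrite ?andbF // !andbT e.
  by exists (fun p => (p.2, p.1)) => -[].
have := @sign_corners N f fP; rewrite sumf => /(_ ltnN) /(canRL (addrK _)) ->; ring.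
Qed.

(** By D U + U D = 1, the factors satisfy c_0 = 1 and c_(n+1) = 1 - c_n, so they alternate between 1
    and 0. *)
Lemma up_down_paths N n f : noninc f -> \sum_(i < N) f i = n -> n < N ->
  up_down N n f = ((~~ odd n)%:R * signed_paths N n f)%R.
Proof.
elim: n f => [|n IHn] f fP sumf ltnN; rewrite (up_down_step fP sumf ltnN).
  rewrite big1 ?subr0 ?mul1r // => t; rewrite /removable => ft.
  by move: sumf; rewrite (bigD1 t) //=; lia.
(* The factor given by induction does not depend on [t]; the sum left after extracting it is
   [signed_paths N n.+1 f]. *)
rewrite [n.+1.-1]/= (eq_bigr (fun t : 'I_N =>
  (~~ odd n)%:R * ((-1) ^+ below N f t * signed_paths N n (del_box f t))))%R.
  by rewrite -big_distrr /=; case: (odd n); rewrite /= ?mul0r ?mul1r ?subr0 ?subrr.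
move=> t ft; rewrite mulrCA IHn //; first exact: noninc_del_box.
  have ft0 : 0 < f t by exact: leq_ltn_trans ft.
  by have := sum_del_box (fun=> true) (ltn_ord t) ft0; rewrite sumf; lia.
exact: ltnW.
Qed.

(** * Summation over partitions *)

Lemma sumn_nth N (s : seq nat) : size s <= N -> sumn s = \sum_(i < N) nth 0 s i.
Proof.
move=> leN; rewrite sumnE (big_nth 0) big_mkord (big_ord_widen N (nth 0 s)) //.
rewrite [RHS](bigID (fun i : 'I_N => i < size s)) /= [X in _ + X]big1 ?addn0 // => i.
by rewrite -leqNgt => /(nth_default 0).
Qed.

Lemma noninc_nth (s : seq nat) : sorted geq s -> noninc (nth 0 s).
Proof.
move=> s_sorted i; have [lti|] := ltnP i.+1 (size s); last by move/(nth_default 0)->.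
exact: (sortedP 0 s_sorted).
Qed.

Lemma intpartP n (l : intpart n) :
  [/\ noninc (nth 0 l), sumn l = n & size l <= n].
Proof.
case: l => s /= /and3P[s_sorted s0 /eqP sums]; split=> //.
  exact: noninc_nth.
by rewrite -sums leq_size_sumn.
Qed.

(** Parts are nonzero while the default of [nth] is 0, so the lengths agree as well. *)
Lemma intpart_inj n (l m : intpart n) : nth 0 l =1 nth 0 m -> l = m.
Proof.
move=> lm; apply: val_inj => /=.
have size_le (a b : intpart n) : nth 0 a =1 nth 0 b -> size a <= size b.
  case: a b => [a pa] [b pb] /= ab; rewrite leqNgt; apply/negP => lt_ba.
  have /and3P[_ /negP a0 _] := pa; apply: a0.
  by rewrite -(nth_default 0 (leqnn (size b))) -ab mem_nth.
by apply: (@eq_from_nth _ 0) => [|i _]; [apply/eqP; rewrite eqn_leq !size_le | exact: lm].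
Qed.

(** This partition only provides the default value for [insubd] in [intpart_of]. *)
Fact is_intpart_nseq n : is_intpart n (nseq n 1).
Proof.
apply/and3P; split; last by rewrite sumn_nseq mul1n.
  by case: n => //= n; elim: n.
by rewrite mem_nseq andbF.
Qed.

(** The zeros of a nonincreasing sequence stand at its end, where the default of [nth] replaces
    them. *)
Lemma nth_filter_neq0 (s : seq nat) i :
  sorted geq s -> nth 0 [seq k <- s | k != 0] i = nth 0 s i.
Proof.
have geq_trans : transitive geq by move=> x y z /=; lia.
elim: s i => //= a s IHs i as_sorted.
have [a0|_] /= := eqVneq a 0; last by case: i => //= i; exact/IHs/(path_sorted as_sorted).
have /allP s0 := order_path_min geq_trans as_sorted.
have -> : [seq k <- s | k != 0] = [::].
  by apply/eqP; rewrite -[_ == _]negbK -has_filter; apply/hasPn => k /s0 /=; lia.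
rewrite nth_nil; case: i => [|i] //=; have [lti|lei] := ltnP i (size s).
  by have := s0 _ (mem_nth 0 lti); rewrite /= a0; lia.
by rewrite nth_default.
Qed.

Definition intpart_of n (f : nat -> nat) : intpart n :=
  insubd (IntPart (is_intpart_nseq n)) [seq k <- mkseq f n | k != 0].

(** If row [n] were nonempty, rows 0 to [n] would already contain [n.+1] boxes. *)
Lemma noninc_support N n f : noninc f -> \sum_(i < N) f i = n -> n < N ->
  forall i, n <= i -> f i = 0.
Proof.
move=> fP sumf ltnN i leni; apply/eqP.
rewrite -leqn0 (leq_trans (noninc_le fP leni)) // leqn0; apply/eqP.
apply: (@noninc_last n.+1) => //; rewrite ltnS -[leqRHS]sumf (big_ord_widen N f) //.
by rewrite [leqRHS](bigID (fun i : 'I_N => i < n.+1)) /= leq_addr.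
Qed.

Lemma nth_intpart_of N n f : noninc f -> \sum_(i < N) f i = n -> n < N ->
  nth 0 (intpart_of n f) =1 f.
Proof.
move=> fP sumf ltnN; have f0 := noninc_support fP sumf ltnN.
have fm_sorted : sorted geq (mkseq f n).
  apply/(sortedP 0) => i; rewrite size_mkseq => lti.
  by rewrite !nth_mkseq ?(ltnW lti) //; exact: fP.
have nth_fm i : nth 0 (mkseq f n) i = f i.
  have [lti|lei] := ltnP i n; first by rewrite nth_mkseq.
  by rewrite f0 // nth_default // size_mkseq.
have nth_fl i : nth 0 [seq k <- mkseq f n | k != 0] i = f i.
  by rewrite nth_filter_neq0.
move=> i; rewrite /intpart_of /insubd insubT /=; last by [].
apply/and3P; split.
- by apply: sorted_filter => // x y z /=; lia.
- by rewrite mem_filter eqxx.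
have sz : size [seq k <- mkseq f n | k != 0] <= n.
  by rewrite size_filter -[n in _ <= n](size_mkseq f) count_size.
rewrite (sumn_nth (leq_trans sz (ltnW ltnN))) -[X in _ == X]sumf.
by apply/eqP/eq_bigr => j _; exact: nth_fl.
Qed.

(** * The signed sum of squares and its recursion *)

Definition odd_sum N (f : nat -> nat) := \sum_(i < N | odd i) f i.

Lemma even_parts_sumE N (s : seq nat) : size s <= N ->
  even_parts_sum s = odd_sum N (nth 0 s).
Proof.
move=> leN; rewrite /even_parts_sum (big_ord_widen_cond N odd (nth 0 s)) //.
rewrite [RHS](bigID (fun i : 'I_N => i < size s)) /= [X in _ + X]big1 ?addn0 // => i.
by rewrite -leqNgt => /andP[_ /(nth_default 0)].
Qed.

Lemma eq_odd_sum N f g : f =1 g -> odd_sum N f = odd_sum N g.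
Proof. by move=> fg; apply: eq_bigr. Qed.

(** [N] is kept apart from [n] so that one bound on the rows serves throughout the recursion on
    [n]. *)
Definition square_sum N n : int :=
  (\sum_(l : intpart n)
     (-1) ^+ odd_sum N (nth 0 l) * signed_paths N n (nth 0 l) ^+ 2)%R.

Lemma sum_intpart N n (l : intpart n) : n <= N -> \sum_(i < N) nth 0 l i = n.
Proof.
by have [_ suml lel] := intpartP l => lenN; rewrite -sumn_nth // (leq_trans lel).
Qed.

(** Deleting and adding a box in row [r] are inverse bijections between the pairs [(l, r)] and
    [(m, r)]. This underlies the adjointness of U and D. *)
Lemma exchange_box N n (F : nat -> (nat -> nat) -> int) : n.+1 < N ->
  (forall r f g, f =1 g -> F r f = F r g) ->
  (\sum_(l : intpart n.+1) \sum_(r < N | removable (nth 0 l) r) F r (nth 0 l)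
   = \sum_(m : intpart n) \sum_(r < N | addable (nth 0 m) r)
       F r (add_box (nth 0 m) r))%R.
Proof.
move=> ltnN eqF.
rewrite (exchange_big_dep xpredT) //= [RHS](exchange_big_dep xpredT) //=.
apply: eq_bigr => r _.
have addE (m : intpart n) : addable (nth 0 m) r ->
    nth 0 (intpart_of n.+1 (add_box (nth 0 m) r)) =1 add_box (nth 0 m) r.
  move=> mr; have [mP _ _] := intpartP m.
  apply: (@nth_intpart_of N) => //; first exact: noninc_add_box.
  by rewrite (sum_add_box xpredT) // sum_intpart ?addn1 //; exact/ltnW/ltnW.
have delE (l : intpart n.+1) : removable (nth 0 l) r ->
    nth 0 (intpart_of n (del_box (nth 0 l) r)) =1 del_box (nth 0 l) r.
  move=> lr; have [lP _ _] := intpartP l.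
  apply: (@nth_intpart_of N) => //; [exact: noninc_del_box | | exact: ltnW].
  have l0 : 0 < nth 0 l r by exact: leq_ltn_trans lr.
  have := sum_del_box xpredT (ltn_ord r) l0.
  by rewrite (sum_intpart l (ltnW ltnN)) addn1 => -[].
rewrite (reindex_onto (fun m : intpart n => intpart_of n.+1 (add_box (nth 0 m) r))
  (fun l : intpart n.+1 => intpart_of n (del_box (nth 0 l) r))) /=; last first.
  move=> l lr; have [lP _ _] := intpartP l; apply: intpart_inj => i.
  rewrite addE; last first.
    by have := del_box_addable lP lr; rewrite /addable !delE.
  rewrite {1}/add_box delE //; apply: del_boxK; exact: leq_ltn_trans lr.
(* The reindexed condition, that [r] is removable after the addition and that deletion restores [m],
   amounts to [r] being addable in [m]. *)
apply: eq_big => [m|m].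
  apply/andP/idP => [[lr /eqP mE]|mr].
    have [lP _ _] := intpartP (intpart_of n.+1 (add_box (nth 0 m) r)).
    by have := del_box_addable lP lr; rewrite /addable -!delE // mE.
  have [mP _ _] := intpartP m.
  have lr : removable (nth 0 (intpart_of n.+1 (add_box (nth 0 m) r))) r.
    by rewrite /removable !addE //; exact: add_box_removable.
  split=> //; apply/eqP/intpart_inj => i.
  by rewrite delE // {1}/del_box addE //; exact: add_boxK.
case/andP=> lr /eqP mE; apply/eqF/addE.
have [lP _ _] := intpartP (intpart_of n.+1 (add_box (nth 0 m) r)).
by have := del_box_addable lP lr; rewrite /addable -!delE // mE.
Qed.

(** By adjointness <U^(n+1), U^(n+1)> = <U^n, D U^(n+1)>, and D U^(n+1) is known from
    [up_down_paths]. *)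
Lemma square_sumS N n : n.+1 < N ->
  square_sum N n.+1 = ((~~ odd n)%:R * square_sum N n)%R.
Proof.
move=> ltnN; rewrite /square_sum big_distrr /=.
pose F r f : int := ((-1) ^+ odd_sum N f * signed_paths N n.+1 f
  * ((-1) ^+ below N f r * signed_paths N n (del_box f r)))%R.
(* Only one of the two factors of the square is expanded. *)
transitivity (\sum_(l : intpart n.+1)
    \sum_(r < N | removable (nth 0 l) r) F r (nth 0 l))%R.
  by apply: eq_bigr => l _; rewrite -big_distrr /= expr2 mulrA.
rewrite exchange_box //; last first.
  move=> r f g fg; rewrite /F (eq_odd_sum _ fg) (eq_signed_paths _ _ fg).
  rewrite (eq_below _ _ fg); congr (_ * (_ * _))%R; apply: eq_signed_paths => i.
  by rewrite /del_box fg.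
apply: eq_bigr => m _; have [mP _ _] := intpartP m.
have UD := up_down_paths mP (sum_intpart m (ltnW (ltnW ltnN))) (ltnW ltnN).
rewrite expr2 mulrCA [(_%:R * _)%R]mulrA -UD [(up_down _ _ _ * _)%R]mulrC.
rewrite /up_down big_distrr /= big_distrr /=; apply: eq_bigr => r _.
rewrite /F (eq_signed_paths _ _ (add_boxK _ r)) below_add_box.
(* This change of e(l) supplies the sign [(-1) ^+ r] in [up_down]. *)
have -> : odd_sum N (add_box (nth 0 m) r) = odd_sum N (nth 0 m) + odd r.
  exact: sum_add_box.
by rewrite exprD signr_odd; ring.
Qed.

(** * Recursion for the imbalance *)

Lemma col_lt l (c : cell l) : col_of c < nth 0 l (row_of c).
Proof. exact: ltn_ord. Qed.

Lemma row_lt l (c : cell l) : row_of c < size l.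
Proof. exact: ltn_ord. Qed.

Lemma cell_inj l (c d : cell l) :
  row_of c = row_of d -> col_of c = col_of d -> c = d.
Proof.
case: c d => i j [i' j']; rewrite /row_of /col_of /= => /val_inj ii'.
by case: i' / ii' j' => j' /val_inj ->.
Qed.

Lemma exists_cell l i j : j < nth 0 l i ->
  exists2 c : cell l, row_of c = i & col_of c = j.
Proof.
move=> ltj; have lti : i < size l.
  by rewrite ltnNge; apply: contraL ltj => /(nth_default 0)->.
by exists (existT _ (Ordinal lti) (Ordinal (ltj : j < nth 0 l (Ordinal lti)))).
Qed.

Lemma card_cell l : #|{: cell l}| = sumn l.
Proof.
rewrite card_tagged sumnE big_map big_enum (eq_bigr (fun i : 'I_(size l) => nth 0 l i)).
  by rewrite sumnE (big_nth 0) big_mkord.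
by move=> i _; rewrite card_ord.
Qed.

Lemma big_cell N l (F : nat -> nat -> nat) : size l <= N ->
  \sum_(c : cell l) F (row_of c) (col_of c) = \sum_(i < N) \sum_(j < nth 0 l i) F i j.
Proof.
move=> leN.
rewrite (bigID (fun i : 'I_N => i < size l)) /= [X in _ = _ + X]big1 => [|i].
  rewrite addn0 -(big_ord_widen N (fun i => \sum_(j < nth 0 l i) F i j)) //.
  by rewrite sig_big_dep.
by rewrite -leqNgt => /(nth_default 0) ->; rewrite big_ord0.
Qed.

(** Reading entries by coordinates, with 0 outside the diagram, allows fillings of different shapes
    to be compared. *)
Definition entry l (T : filling l) i j : nat :=
  oapp (fun c => T c : nat) 0 [pick c | (row_of c == i) && (col_of c == j)].

Lemma entryE l (T : filling l) c : entry T (row_of c) (col_of c) = T c.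
Proof.
rewrite /entry; case: pickP => [d /andP[/eqP rd /eqP cd]|/(_ c)]; last by rewrite !eqxx.
by rewrite (cell_inj rd cd).
Qed.

Lemma eq_filling l (T U : filling l) :
  (forall i j, j < nth 0 l i -> entry T i j = entry U i j) -> T = U.
Proof.
move=> TU; apply/ffunP => c; apply: val_inj => /=.
by rewrite -!entryE; apply/TU/col_lt.
Qed.

Lemma entry_le m (T : filling m) i j : entry T i j <= sumn m.
Proof. by rewrite /entry; case: pickP => //= c _; rewrite -ltnS. Qed.

Definition filling_of l (g : nat -> nat -> nat) : filling l :=
  [ffun c => inord (g (row_of c) (col_of c))].

Lemma entry_filling_of l g i j : j < nth 0 l i -> g i j <= sumn l ->
  entry (filling_of l g) i j = g i j.
Proof. by move=> /exists_cell[c <- <-] leg; rewrite entryE ffunE inordK. Qed.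

(** Range and injectivity replace the condition that the entries are a permutation of 1, ..., n. *)
Record standard_fun l (g : nat -> nat -> nat) : Prop := StandardFun {
  std_range : forall i j, j < nth 0 l i -> 0 < g i j <= sumn l;
  std_inj : forall i j i' j', j < nth 0 l i -> j' < nth 0 l i' ->
    g i j = g i' j' -> i = i' /\ j = j';
  std_row : forall i j k, j < k -> k < nth 0 l i -> g i j < g i k;
  std_col : forall i k j, i < k -> j < nth 0 l i -> j < nth 0 l k -> g i j < g k j }.

Lemma standardP l (T : filling l) :
  reflect (standard_fun l (entry T)) (standard_tableau T).
Proof.
apply: (iffP and3P) => [[perm_T /forallP rowT /forallP colT] | [rT iT rowT colT]].
  have uniqT : uniq [seq val (T c) | c : cell l].
    by rewrite (perm_uniq perm_T) iota_uniq.
  split.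
  - move=> _ _ /exists_cell[c <- <-]; rewrite entryE.
    have : val (T c) \in iota 1 (sumn l) by rewrite -(perm_mem perm_T);
      exact: (image_f (fun c => val (T c))).
    by rewrite mem_iota add1n ltnS.
  - move=> _ _ _ _ /exists_cell[c <- <-] /exists_cell[d <- <-]; rewrite !entryE => eT.
    by have /injectiveP/(_ c d eT)-> : injectiveb (fun c => val (T c)).
  - move=> i j k ltjk ltk; have ltj := ltn_trans ltjk ltk.
    have [c rc cc] := exists_cell ltj; have [d rd cd] := exists_cell ltk.
    have /forallP/(_ d)/implyP := rowT c.
    by rewrite -!entryE rc rd cc cd eqxx; apply.
  move=> i k j ltik /exists_cell[c rc cc] /exists_cell[d rd cd].
  have /forallP/(_ d)/implyP := colT c.
  by rewrite -!entryE rc rd cc cd eqxx; apply.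
split.
- have uniqT : uniq [seq val (T c) | c : cell l].
    apply/injectiveP => c d eT; have : T c = T d :> nat := eT.
    by rewrite -!entryE => /(iT _ _ _ _ (col_lt c) (col_lt d))[]; apply: cell_inj.
  apply: uniq_perm => //; first exact: iota_uniq.
  (* Pigeonhole: as many distinct entries as there are values in the range must exhaust it. *)
  have [||//] := uniq_min_size uniqT (s2 := iota 1 (sumn l)).
    move=> _ /imageP[c _ ->]; have := rT _ _ (col_lt c); rewrite entryE mem_iota /=; lia.
  by rewrite size_iota size_image card_cell.
- apply/forallP => c; apply/forallP => d; apply/implyP => /andP[/eqP rcd lt].
  by rewrite -!entryE rcd; apply: rowT => //; exact: col_lt.
apply/forallP => c; apply/forallP => d; apply/implyP => /andP[/eqP ccd lt].
by rewrite -!entryE ccd; apply: colT => //; [rewrite -ccd|]; exact: col_lt.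
Qed.

Lemma standard_max l (T : filling l) : 0 < sumn l -> standard_tableau T ->
  exists c : cell l, T c = sumn l :> nat.
Proof.
move=> l0 /and3P[perm_T _ _].
have : sumn l \in [seq val (T c) | c : cell l] by rewrite (perm_mem perm_T) mem_iota; lia.
by case/imageP=> c _ e; exists c.
Qed.

Lemma invE l (T : filling l) : Defs.inv T =
  \sum_(c : cell l) \sum_(d : cell l)
    ((entry T (row_of d) (col_of d) < entry T (row_of c) (col_of c))
     && (row_of c < row_of d)).
Proof.
rewrite /Defs.inv -sum1dep_card pair_bigA big_mkcond /=; apply: eq_bigr => p _.
by rewrite !entryE; case: ifP.
Qed.

(** * Tableaux with their largest entry in a given corner *)

Section RemoveCorner.

Variables (l l' : seq nat) (r : nat).
Hypothesis r_corner : removable (nth 0 l) r.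
Hypothesis nth_l' : nth 0 l' =1 del_box (nth 0 l) r.

(** The removed box thus lies in column [nth 0 l' r] of row [r]. *)
Let rowr : nth 0 l r = (nth 0 l' r).+1.
Proof. by rewrite nth_l' /del_box eqxx; move: r_corner; rewrite /removable; lia. Qed.

Let nth_le i : nth 0 l' i <= nth 0 l i.
Proof. by rewrite nth_l' leq_subr. Qed.

Lemma sumn_corner : sumn l = (sumn l').+1.
Proof.
pose N := maxn (maxn (size l) (size l')) r.+1.
rewrite (@sumn_nth N l) ?(@sumn_nth N l') ?leq_max ?leqnn ?orbT //.
under [X in _ = X.+1]eq_bigr => i _ do rewrite nth_l'.
rewrite -(@sum_del_box N xpredT _ r) ?addn1 ?rowr //.
by rewrite leq_max leqnn orbT.
Qed.

Let corner_or i j : j < nth 0 l i -> j < nth 0 l' i \/ i = r /\ j = nth 0 l' r.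
Proof.
have := rowr; have := nth_l' i; rewrite /del_box.
by have [->|] := eqVneq i r; lia.
Qed.

Lemma big_cell_corner (F : nat -> nat -> nat) :
  \sum_(c : cell l) F (row_of c) (col_of c)
  = \sum_(c : cell l') F (row_of c) (col_of c) + F r (nth 0 l' r).
Proof.
pose N := maxn (maxn (size l) (size l')) r.+1.
rewrite !(@big_cell N) ?leq_max ?leqnn ?orbT //.
have rN : r < N by rewrite leq_max leqnn orbT.
rewrite (bigD1 (Ordinal rN)) //= [in RHS](bigD1 (Ordinal rN)) //=.
rewrite rowr big_ord_recr /= addnAC; congr (_ + _ + _).
apply: eq_bigr => i; rewrite -val_eqE /= => /negPf nir.
by rewrite nth_l' /del_box nir subn0.
Qed.

Definition remove_corner (T : filling l) : filling l' := filling_of l' (entry T).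

Definition fill_corner (T : filling l') : filling l :=
  filling_of l (fun i j => if j < nth 0 l' i then entry T i j else sumn l).

Lemma entry_fill T i j : j < nth 0 l i ->
  entry (fill_corner T) i j = if j < nth 0 l' i then entry T i j else sumn l.
Proof.
move=> ltj; rewrite entry_filling_of //; case: ifP => // _.
by rewrite (leq_trans (entry_le _ _ _)) // sumn_corner.
Qed.

Hypothesis l_sorted : sorted geq l.

Lemma standard_fill T : standard_tableau T -> standard_tableau (fill_corner T).
Proof.
move=> /standardP[rT iT rowT colT]; apply/standardP.
have lP := noninc_nth l_sorted.
split.
- move=> i j ltj; rewrite entry_fill //; case: ifP => [/rT|_]; rewrite sumn_corner; lia.
- move=> i j i' j' ltj ltj'; rewrite !entry_fill //.
  have [lj|[-> ->]] := corner_or ltj; have [lj'|[-> ->]] := corner_or ltj';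
  rewrite ?lj ?lj' ?ltnn //.
  + exact: iT.
  + by have := rT _ _ lj; rewrite sumn_corner; lia.
  by have := rT _ _ lj'; rewrite sumn_corner; lia.
- move=> i j k ltjk ltk; have ltj := ltn_trans ltjk ltk.
  rewrite !entry_fill //; have [lk|[ei ek]] := corner_or ltk.
    by rewrite lk (ltn_trans ltjk lk) rowT.
  by subst; rewrite ltnn ltjk; have := rT _ _ ltjk; rewrite sumn_corner; lia.
move=> i k j ltik lti ltk; rewrite !entry_fill //.
(* The upper cell of a column pair is not the corner, which has no cell below it. *)
have lji : j < nth 0 l' i.
  have [//|[ei ej]] := corner_or lti; move: ltk; subst.
  by move: (noninc_le lP ltik) r_corner rowr; rewrite /removable; lia.
rewrite lji; case: ifP => [ljk|_]; first exact: colT.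
by have := rT _ _ lji; rewrite sumn_corner; lia.
Qed.

Lemma fill_cornerK T : remove_corner (fill_corner T) = T.
Proof.
apply: eq_filling => i j ltj.
have E : entry (fill_corner T) i j = entry T i j.
  by rewrite entry_fill ?ltj // (leq_trans ltj).
by rewrite entry_filling_of // E // entry_le.
Qed.

Section Remove.

Variable T : filling l.
Hypothesis T_std : standard_tableau T.
Hypothesis T_max : entry T r (nth 0 l' r) = sumn l.

(** By injectivity the largest value occurs only in the corner, so every other entry fits the
    smaller range. *)
Let entry_remove i j : j < nth 0 l' i ->
  entry (remove_corner T) i j = entry T i j /\ entry T i j <= sumn l'.
Proof.
move=> ltj; have [rT iT _ _] := elimT (standardP T) T_std.
have ltjl := leq_trans ltj (nth_le i).
suff le : entry T i j <= sumn l' by split; rewrite // entry_filling_of.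
rewrite -ltnS -sumn_corner ltn_neqAle (andP (rT _ _ ltjl)).2 andbT.
apply/eqP; rewrite -T_max => /iT[]//; first by rewrite rowr.
by move=> ei ej; move: ltj; rewrite ei ej ltnn.
Qed.

Lemma remove_cornerK : fill_corner (remove_corner T) = T.
Proof.
apply: eq_filling => i j ltj; rewrite entry_fill //.
by have [lj|[->->]] := corner_or ltj; rewrite ?lj ?ltnn //; case: (entry_remove lj).
Qed.

Lemma standard_remove : standard_tableau (remove_corner T).
Proof.
have [rT iT rowT colT] := elimT (standardP T) T_std; apply/standardP; split.
- move=> i j ltj; have [-> ->] := entry_remove ltj; rewrite andbT.
  by case/andP: (rT i j (leq_trans ltj (nth_le i))).
- move=> i j i' j' ltj ltj'; rewrite (entry_remove ltj).1 (entry_remove ltj').1.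
  by apply: iT; apply: leq_trans (nth_le _).
- move=> i j k ltjk ltk; rewrite (entry_remove ltk).1.
  rewrite (entry_remove (ltn_trans ltjk ltk)).1.
  by apply: rowT => //; apply: leq_trans (nth_le _).
move=> i k j ltik lti ltk; rewrite (entry_remove lti).1 (entry_remove ltk).1.
by apply: colT => //; apply: leq_trans (nth_le _).
Qed.

End Remove.

(** The largest entry forms an inversion with each entry in a lower row and with no other; all other
    pairs are unchanged. *)
Lemma inv_fill N T : size l <= N -> size l' <= N ->
  Defs.inv (fill_corner T) = Defs.inv T + below N (nth 0 l) r.
Proof.
move=> leN leN'; rewrite !invE.
pose F g i j := \sum_(d : cell l)
  ((g (row_of d) (col_of d) < g i j) && (i < row_of d)).
rewrite (big_cell_corner (F (entry (fill_corner T)))); congr (_ + _).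
  apply: eq_bigr => c _; rewrite /F.
  rewrite (big_cell_corner (fun i j => (entry (fill_corner T) i j < _) && (_ < i))).
  have ltc := leq_trans (col_lt c) (nth_le _).
  (* The corner is never the smaller entry of an inversion. *)
  rewrite [X in _ + X](_ : _ = 0) ?addn0.
    apply: eq_bigr => d _; have ltd := leq_trans (col_lt d) (nth_le _).
    by rewrite !entry_fill // !col_lt.
  rewrite entry_fill ?rowr // ltnn ltnNge.
  by rewrite entry_le.
rewrite /F (big_cell_corner (fun i j => (entry (fill_corner T) i j < _) && (_ < i))).
rewrite ltnn andFb addn0 entry_fill ?rowr // ltnn.
rewrite (eq_bigr (fun d : cell l' => nat_of_bool (r < row_of d))); last first.
  move=> d _; have ltd := leq_trans (col_lt d) (nth_le _).
  by rewrite entry_fill // col_lt sumn_corner ltnS entry_le.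
rewrite (big_cell (fun i _ => nat_of_bool (r < i)) leN') [RHS]big_mkcond.
apply: eq_bigr => i _; rewrite sum_nat_const card_ord nth_l' /del_box.
by case: ltngtP => //= _; rewrite ?muln0 // subn0 muln1.
Qed.

(** [fill_corner] and [remove_corner] are inverse bijections, and [inv_fill] gives the sign. *)
Lemma sum_max_corner N : size l <= N -> size l' <= N ->
  (\sum_(T : filling l | standard_tableau T && (entry T r (nth 0 l' r) == sumn l))
     (-1) ^+ Defs.inv T = (-1) ^+ below N (nth 0 l) r * imbalance l')%R.
Proof.
move=> leN leN'; rewrite (reindex_onto fill_corner remove_corner); last first.
  by move=> T /andP[T_std /eqP]; exact: remove_cornerK.
rewrite /imbalance big_distrr /=; apply: eq_big => [T|T _]; last first.
  by rewrite (inv_fill _ leN leN') addnC exprD.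
rewrite fill_cornerK eqxx andbT; apply/andP/idP => [[std /eqP max]|T_std].
  by rewrite -(fill_cornerK T); exact: standard_remove.
by split; [exact: standard_fill | rewrite entry_fill ?rowr ?ltnn].
Qed.

End RemoveCorner.

(** * Expansion of the imbalance along the largest entry *)

Lemma imbalance0 l : sumn l = 0 -> imbalance l = 1%R.
Proof.
move=> l0; have nocell i j : j < nth 0 l i -> False.
  by have := leq_nth_sumn l i; rewrite l0; lia.
pose T0 := filling_of l (fun _ _ => 0).
have allT (T : filling l) : T = T0 by apply: eq_filling => i j /nocell.
rewrite /imbalance (big_pred1 T0) => [|T].
  by rewrite invE big1 // => c _; case: (nocell _ _ (col_lt c)).
rewrite (allT T) [RHS]eqxx; apply/standardP; split.
- by move=> i j /nocell.
- by move=> i j i' j' /nocell.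
- by move=> i j k _ /nocell.
by move=> i j k _ /nocell.
Qed.

(** No cell lies to the right of the largest entry or below it, so it ends its row and occupies a
    corner. *)
Lemma row_max_unique l (T : filling l) r : 0 < sumn l -> standard_tableau T ->
  removable (nth 0 l) r && (entry T r (nth 0 l r).-1 == sumn l)
  = [exists c : cell l, (row_of c == r) && (T c == sumn l :> nat)].
Proof.
move=> l0 T_std; have [rT iT rowT colT] := elimT (standardP T) T_std.
have lt_last i : 0 < nth 0 l i -> (nth 0 l i).-1 < nth 0 l i by lia.
apply/andP/existsP => [[r_corner /eqP max]|[c /andP[/eqP <- /eqP max]]].
  have [|c cr cc] := @exists_cell l r (nth 0 l r).-1.
    by apply: lt_last; apply: leq_ltn_trans r_corner.
  by exists c; rewrite cr eqxx -entryE cr cc max /=.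
have ltc := col_lt c; have leT := entry_le T.
have col_c : col_of c = (nth 0 l (row_of c)).-1.
  suff : ~ col_of c < (nth 0 l (row_of c)).-1 by lia.
  move=> lt; have := rowT _ _ _ lt (lt_last _ (leq_ltn_trans (leq0n _) ltc)).
  by rewrite entryE max ltnNge leT.
rewrite -col_c entryE max eqxx; split=> //.
rewrite /removable ltnNge; apply/negP => le.
by have := colT _ _ _ (ltnSn _) ltc (leq_trans ltc le); rewrite entryE max ltnNge leT.
Qed.

(** Sorted sequences are used instead of [intpart] because deleting the only box of a row leaves a
    zero in [l']. *)
Lemma imbalanceE N n l : sorted geq l -> sumn l = n -> size l <= N ->
  imbalance l = signed_paths N n (nth 0 l).
Proof.
elim: n l => [|n IHn] l l_sorted suml leN; first by rewrite imbalance0.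
have l0 : 0 < sumn l by rewrite suml.
pose l' (r : nat) := mkseq (del_box (nth 0 l) r) (size l).
have nth_l' r : nth 0 (l' r) =1 del_box (nth 0 l) r.
  move=> i; have [lti|lei] := ltnP i (size l); first by rewrite nth_mkseq.
  by rewrite nth_default ?size_mkseq // /del_box nth_default.
have size_l' r : size (l' r) <= N by rewrite size_mkseq.
(* Tableaux are grouped by the row of their largest entry. *)
transitivity (\sum_(r < N | removable (nth 0 l) r) \sum_(T : filling l |
    standard_tableau T && (entry T r (nth 0 (l' r) r) == sumn l))
  (-1) ^+ Defs.inv T : int)%R.
  rewrite (exchange_big_dep (@standard_tableau l)) /= => [|r T _ /andP[]//].
  apply: eq_bigr => T T_std; have [c max] := standard_max l0 T_std.
  rewrite (big_pred1 (Ordinal (leq_trans (row_lt c) leN))) // => r /=.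
  rewrite T_std /= nth_l' /del_box eqxx subn1 row_max_unique //.
  apply/existsP/eqP => [[d /andP[/eqP rd /eqP maxd]]|->]; last first.
    by exists c; rewrite max !eqxx.
  have [_ iT _ _] := elimT (standardP T) T_std; apply: val_inj; rewrite /= -rd.
  by apply: (proj1 (iT _ _ _ _ (col_lt d) (col_lt c) _)); rewrite !entryE max.
apply: eq_bigr => r r_corner.
rewrite (sum_max_corner r_corner (nth_l' r) l_sorted leN (size_l' r)); congr (_ * _)%R.
rewrite (IHn (l' r)) //; first exact: eq_signed_paths.
  have lP := noninc_del_box (noninc_nth l_sorted) r_corner.
  by apply/(sortedP 0) => i _; rewrite !nth_l'; exact: lP.
by have := sumn_corner r_corner (nth_l' r); rewrite suml => -[].
Qed.

Theorem theorem5p1 (n : nat) (hn : (2 <= n)%N) :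
  (\sum_(l : intpart n) (-1) ^+ even_parts_sum l * imbalance l ^+ 2 = 0 :> int)%R.
Proof.
(* With [n.+1] rows, the last one is empty in every partition of [n]. *)
rewrite (eq_bigr (fun l : intpart n => (-1) ^+ odd_sum n.+1 (nth 0 l) *
  signed_paths n.+1 n (nth 0 l) ^+ 2)%R); last first.
  case=> l l_part _ /=; have /and3P[l_sorted l0 /eqP suml] := l_part.
  have lel : size l <= n.+1 by rewrite ltnW // ltnS -suml leq_size_sumn.
  by rewrite (even_parts_sumE lel) (imbalanceE l_sorted suml lel).
case: n hn => [|[|n]] // _; rewrite -/(square_sum _ _).
(* Two steps of the recursion give factors for two consecutive parities, one of which vanishes. *)
by rewrite !square_sumS //=; case: (odd n); rewrite /= ?mul0r ?mulr0.
Qed.
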